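(* Let $q=2^h$ with $h\ge 1$ an integer, let $V_6=V(6,q)$ be a 6-dimensional vector space over $\mathrm{GF}(q)$ with basis $e_1,\dots,e_6$ and dual basis $f_1,\dots,f_6$ of $V_6^{\ast}$, and write $f_{ijk}:=f_i\wedge f_j\wedge f_k$. (1) If $h$ is odd, then the alternating trilinear form $T$ on $V_6$ given by the dual trivector $$t=f_{234}+f_{135}+f_{126}+f_{156}+f_{246}+f_{345}$$ is such that the set $\mathcal{L}_T$ of all $T$-singular lines is a Desarguesian line-spread in $\mathrm{PG}(5,q)=\mathbb{P}V_6$. (2) If $h$ is even, then for any $\mu\in\mathrm{GF}(q)$ satisfying $\operatorname{tr}(\mu)=1$, the alternating trilinear form $T$ on $V_6$ given by the dual trivector $$t=f_{234}+f_{135}+f_{126}+f_{156}+f_{246}+f_{345}+\mu f_{456}$$ is such that $\mathcal{L}_T$ is a Desarguesian line-spread in $\mathrm{PG}(5,q)$.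
   Context: For $q=2^h$, $\operatorname{tr}:\mathrm{GF}(q)\to\mathrm{GF}(2)$ is the absolute trace $\operatorname{tr}(\mu)=\mu+\mu^2+\mu^4+\dots+\mu^{2^{h-1}}$. A dual trivector $t\in\wedge^3V_n^{\ast}$ gives the alternating trilinear form $T(x,y,z)=\langle t\,|\,x\wedge y\wedge z\rangle$, where the pairing is determined by linearity and $\langle g_1\wedge g_2\wedge g_3\,|\,v_1\wedge v_2\wedge v_3\rangle=\det[g_i(v_j)]$ for $g_i\in V_n^{\ast}$, $v_j\in V_n$. Equivalently, if $t=\sum_{i<j<k}c_{ijk}f_{ijk}$ then $T(e_i,e_j,e_k)=c_{ijk}$ for $i<j<k$. Alternating means that $T(x,y,z)=0$ whenever two of the arguments are equal. A line $\langle a,b\rangle$ of $\mathbb{P}V_n$ (a 2-dimensional subspace of $V_n$ spanned by linearly independent $a,b$) is $T$-singular if $T(a,b,x)=0$ for all $x\in V_n$; $\mathcal{L}_T$ denotes the set of all $T$-singular lines. A line-spread in $\mathbb{P}V_n$ is a set of lines such that each point of $\mathbb{P}V_n$ lies on precisely one line of the set. A line-spread in $\mathrm{PG}(5,q)=\mathbb{P}V_6$ is Desarguesian if $V_6$ can be given the structure of a 3-dimensional vector space over $\mathrm{GF}(q^2)$, extending its $\mathrm{GF}(q)$-vector space structure, in such a way that the lines of the spread are exactly the 1-dimensional $\mathrm{GF}(q^2)$-subspaces, i.e. (for any $\rho\in\mathrm{GF}(q^2)\setminus\mathrm{GF}(q)$) the lines $\langle a,\rho a\rangle$, $0\ne a\in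 V_6$. *)

(* Defs.v *)
From HB Require Import structures.
From mathcomp Require Import all_boot all_order all_algebra all_field.
From mathcomp Require Import ring.

Set Implicit Arguments.
Unset Strict Implicit.
Unset Printing Implicit Defensive.

Import GRing.Theory.
Local Open Scope ring_scope.

Definition absolute_trace (R : nzRingType) (h : nat) (mu : R) : R :=
  \sum_(i < h) mu ^+ (2 ^ i).

Section Trilinear.
Variables (K : fieldType) (V : vectType K).

Definition trilinear_form := 'Hom(V, 'Hom(V, 'Hom(V, K^o))).

Definition alternating (T : trilinear_form) : Prop :=
  forall x y, [/\ T x x y = 0, T x y x = 0 & T y x x = 0].

Definition pairing (g1 g2 g3 : 'Hom(V, K^o)) (v1 v2 v3 : V) : K :=
  \det (\matrix_(i < 3, j < 3)
          tnth [tuple g1; g2; g3] i (tnth [tuple v1; v2; v3] j)).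

(* Dual trivectors are identified with the alternating trilinear forms they
   induce: g1 /\ g2 /\ g3 is the form (v1, v2, v3) |-> det [g_i (v_j)].  As
   [linfun f] is meaningful only for linear f, see [wedge3E]. *)
Definition wedge3 (g1 g2 g3 : 'Hom(V, K^o)) : trilinear_form :=
  linfun (fun v1 => linfun (fun v2 => linfun (fun v3 =>
    pairing g1 g2 g3 v1 v2 v3 : K^o))).

Lemma pairingE (g1 g2 g3 : 'Hom(V, K^o)) v1 v2 v3 :
  pairing g1 g2 g3 v1 v2 v3 =
    (g1 v1 : K) * ((g2 v2 : K) * (g3 v3 : K) - (g3 v2 : K) * (g2 v3 : K))
    - (g1 v2 : K) * ((g2 v1 : K) * (g3 v3 : K) - (g3 v1 : K) * (g2 v3 : K))
    + (g1 v3 : K) * ((g2 v1 : K) * (g3 v2 : K) - (g3 v1 : K) * (g2 v2 : K)).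
Proof.
rewrite /pairing (expand_det_row _ ord0) !big_ord_recl big_ord0 /cofactor.
rewrite !(expand_det_row _ ord0) !big_ord_recl !big_ord0 /cofactor !det_mx11.
rewrite !mxE /= !(tnth_nth 0) /=; ring.
Qed.

Lemma linfun_ofE (U W : vectType K) (f : U -> W) : linear f -> linfun f =1 f.
Proof.
move=> lf; pose m := GRing.isLinear.Build K U W *:%R f lf.
pose fL : {linear U -> W} := HB.pack f m.
exact: (lfunE fL).
Qed.

Lemma pairing_linear g1 g2 g3 a x y v w :
  [/\ pairing g1 g2 g3 (a *: x + y) v w
        = a * pairing g1 g2 g3 x v w + pairing g1 g2 g3 y v w,
      pairing g1 g2 g3 v (a *: x + y) w
        = a * pairing g1 g2 g3 v x w + pairing g1 g2 g3 v y w &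
      pairing g1 g2 g3 v w (a *: x + y)
        = a * pairing g1 g2 g3 v w x + pairing g1 g2 g3 v w y].
Proof.
have E (g : 'Hom(V, K^o)) : (g (a *: x + y) : K) = a * (g x : K) + (g y : K).
  by rewrite linearP.
by split; rewrite !pairingE !E; ring.
Qed.

Lemma wedge3E (g1 g2 g3 : 'Hom(V, K^o)) v1 v2 v3 :
  wedge3 g1 g2 g3 v1 v2 v3 = pairing g1 g2 g3 v1 v2 v3.
Proof.
have l3 u1 u2 : linear (fun u3 => pairing g1 g2 g3 u1 u2 u3 : K^o).
  by move=> a x y; case: (pairing_linear g1 g2 g3 a x y u1 u2).
have l2 u1 : linear (fun u2 =>
    linfun (fun u3 => pairing g1 g2 g3 u1 u2 u3 : K^o)).
  move=> a x y; apply/lfunP => z; rewrite add_lfunE scale_lfunE !linfun_ofE //.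
  by case: (pairing_linear g1 g2 g3 a x y u1 z).
have l1 : linear (fun u1 => linfun (fun u2 =>
    linfun (fun u3 => pairing g1 g2 g3 u1 u2 u3 : K^o))).
  move=> a x y; apply/lfunP => z; apply/lfunP => w.
  do 2! rewrite add_lfunE scale_lfunE.
  rewrite !(linfun_ofE (l2 _)) !(linfun_ofE (l3 _ _)).
  by case: (pairing_linear g1 g2 g3 a x y z w).
by rewrite /wedge3 linfun_ofE // linfun_ofE // linfun_ofE.
Qed.

Lemma wedge3_alternating (g1 g2 g3 : 'Hom(V, K^o)) :
  alternating (wedge3 g1 g2 g3).
Proof. by move=> x y; split; rewrite wedge3E pairingE; ring. Qed.

Lemma alternating_linear (a : K) (S T : trilinear_form) :
  alternating S -> alternating T -> alternating (a *: S + T).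
Proof.
move=> altS altT x y; have [S1 S2 S3] := altS x y; have [T1 T2 T3] := altT x y.
by split; rewrite !(add_lfunE, scale_lfunE) ?S1 ?S2 ?S3 ?T1 ?T2 ?T3 scaler0 addr0.
Qed.

(* For alternating T, whether T a b x vanishes for all x depends only on the
   line spanned by a and b. *)
Definition singular_line (T : trilinear_form) (L : {vspace V}) : Prop :=
  exists a b : V,
    [/\ free [:: a; b], L = <<[:: a; b]>>%VS & forall x, T a b x = 0].

Definition line_spread (S : {vspace V} -> Prop) : Prop :=
  (forall L, S L -> \dim L = 2%N) /\
  (forall P : {vspace V}, \dim P = 1%N -> exists! L, S L /\ (P <= L)%VS).

(* The structure of 3-dimensional vector space over the quadratic extension E
   of K is the one carried to V from W by the additive bijection phi; that it
   extends the K-structure of V is the condition on a%:A. *)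
Definition desarguesian_line_spread (S : {vspace V} -> Prop) : Prop :=
  line_spread S /\
  exists (E : fieldExtType K) (W : vectType E) (phi : {additive W -> V}),
    [/\ \dim {:E} = 2%N, \dim {:W} = 3%N, bijective phi,
        forall (a : K) (w : W), phi (a%:A *: w) = a *: phi w &
        forall L : {vspace V}, S L <->
          exists2 U : {vspace W}, \dim U = 1%N &
            forall w, (phi w \in L) = (w \in U)].

End Trilinear.

Section DualBasis.
Variables (K : fieldType) (V : vectType K) (n : nat) (e : n.+1.-tuple V).

(* Basis vectors are numbered from 1, as usual on paper: f_i is the coordinate
   of index i - 1 in the tuple e. *)
Definition dual_basis (i : nat) : 'Hom(V, K^o) :=
  linfun (coord e (inord i.-1) : V -> K^o).

Definition dual_wedge (i j k : nat) : trilinear_form V :=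
  wedge3 (dual_basis i) (dual_basis j) (dual_basis k).

Lemma dual_basisE i v : dual_basis i v = coord e (inord i.-1) v.
Proof. exact: lfunE. Qed.

End DualBasis.

(* Main.v *)
From HB Require Import structures.
Require Import Defs.
From mathcomp Require Import all_boot all_order all_algebra all_field.
From mathcomp Require Import ring.

Set Implicit Arguments.
Unset Strict Implicit.
Unset Printing Implicit Defensive.

Import GRing.Theory.
Local Open Scope ring_scope.

(* Let rho be a root of X^2 + X + mu + 1, which is irreducible over K because
   tr (mu + 1) = 1 (with mu = 0 for odd h), and let E = K(rho).  Identify V with
   E^3 by sending x to (x_i + rho x_(i+3)), i = 1, 2, 3; since
   rho^3 = mu rho + mu + 1, expanding the determinant shows that T (x, y, z) is
   the coefficient of rho in det (x, y, z).  The determinants det (a, b, z) form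
   an E-subspace of E, so T (a, b, -) = 0 forces det (a, b, -) = 0, that is, a
   and b are linearly dependent over E. *)

(** * The absolute trace in characteristic 2 *)

Lemma absolute_traceD (R : comNzRingType) (h : nat) (x y : R) :
  2%N \in [pchar R] ->
  absolute_trace h (x + y) = absolute_trace h x + absolute_trace h y.
Proof.
move=> char2; rewrite /absolute_trace -big_split; apply: eq_bigr => i _ /=.
by rewrite exprDn_pchar // pnatX pnatE ?char2.
Qed.

Lemma absolute_trace1 (R : nzRingType) (h : nat) :
  absolute_trace h (1 : R) = h%:R.
Proof.
rewrite /absolute_trace (eq_bigr (fun=> 1)) => [|i _]; last exact: expr1n.
by rewrite sumr_const card_ord.
Qed.

(** Squaring shifts the exponents of the trace cyclically, since [x ^+ (2 ^ h) = x]; so [x ^+ 2] and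
    [x] have equal traces, which cancel. *)
Lemma absolute_trace_AS (F : finFieldType) (h : nat) (x : F) :
  #|F| = (2 ^ h)%N -> 2%N \in [pchar F] -> absolute_trace h (x ^+ 2 + x) = 0.
Proof.
move=> cardF char2; rewrite absolute_traceD // /absolute_trace.
under eq_bigr do rewrite -exprM -expnS.
have -> : \sum_(i < h) x ^+ (2 ^ i.+1) = \sum_(i < h) x ^+ (2 ^ i).
  (* Add [x] on both sides, read as the power for exponent [2 ^ 0] on the left and [2 ^ h] on the
     right: both become the sum over [i <= h]. *)
  apply: (addIr x); rewrite -[X in _ = _ + X](expf_card x) cardF.
  rewrite -[RHS](big_ord_recr h (fun i : 'I_h.+1 => x ^+ (2 ^ i))).
  by rewrite big_ord_recl /= expr1 addrC.
exact: addrr_pchar2.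
Qed.

Lemma dim1_line (K : fieldType) (V : vectType K) (P : {vspace V}) :
  \dim P = 1%N -> exists2 v, v != 0 & P = <[v]>%VS.
Proof.
move=> dimP; have nz : vpick P != 0 by rewrite vpick0 -dimv_eq0 dimP.
exists (vpick P) => //; apply/esym/eqP.
by rewrite eqEdim -memvE memv_pick dimP dim_vline nz.
Qed.

(** * Coordinates in a quadratic extension *)

Section QuadraticExtension.
Variables (K : fieldType) (E : fieldExtType K) (rho : E).
Hypotheses (dimE : \dim {:E} = 2%N) (rho_notin : rho \notin 1%VS).

(** With [rho] listed first, index 0 reads the coefficient of [rho] and index 1 the constant
    term. *)
Definition qcoord (i : 'I_2) : E -> K := coord [tuple rho; 1] i.

Lemma quadratic_basis : basis_of {:E} [tuple rho; 1].
Proof.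
rewrite basisEfree subvf dimE leqnn !andbT free_cons span_seq1 rho_notin.
by rewrite seq1_free oner_neq0.
Qed.

Lemma qcoordE y : y = qcoord 1 y *: 1 + qcoord 0 y *: rho.
Proof.
rewrite [LHS](coord_basis quadratic_basis (memvf y)) addrC.
by rewrite big_ord_recl big_ord1; congr (_ + coord _ _ _ *: _); apply: val_inj.
Qed.

Lemma qcoord_comb a b i :
  qcoord i (a *: 1 + b *: rho) = if i == 0 then b else a.
Proof.
pose k (j : 'I_2) := if j == 0 then b else a.
rewrite -[RHS]/(k i) -(coord_sum_free (X := [tuple rho; 1]) k).
  by rewrite big_ord_recl big_ord1 /= addrC.
exact: (basis_free quadratic_basis).
Qed.

End QuadraticExtension.

(** * Lines of [V] coming from one-dimensional [E]-subspaces of [W] *)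

Section FieldReduction.
Variables (K : fieldType) (E : fieldExtType K) (rho : E).
Hypotheses (dimE : \dim {:E} = 2%N) (rho_notin : rho \notin 1%VS).
Variables (V : vectType K) (W : vectType E).
Variables (phi : {additive W -> V}) (psi : V -> W).
Hypotheses (phiK : cancel phi psi) (psiK : cancel psi phi).
Hypothesis phiZ : forall (a : K) (w : W), phi (a%:A *: w) = a *: phi w.

(** The image under [phi] of the [E]-span of [w], given by [K]-generators because [phi] is only
    additive and [W] is a space over [E]. *)
Definition ext_line (w : W) : {vspace V} := <<[:: phi w; phi (rho *: w)]>>%VS.

Lemma phi_comb (a b : K) (w : W) :
  phi ((a *: 1 + b *: rho) *: w) = a *: phi w + b *: phi (rho *: w).
Proof. by rewrite scalerDl raddfD -[b *: rho]mulr_algl -scalerA !phiZ. Qed.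

Lemma mem_ext_line u w : (phi u \in ext_line w) = (u \in <[w]>%VS).
Proof.
rewrite /ext_line span_cons span_seq1; apply/idP/vlineP => [|[y ->]].
  case/memv_addP=> _ /vlineP[a ->] [_ /vlineP[b ->]]; rewrite -phi_comb.
  by move/(can_inj phiK) => ->; eexists.
rewrite [y](qcoordE dimE rho_notin) phi_comb.
by rewrite memv_add ?memvZ ?memv_line.
Qed.

(** A relation [phi w = b *: phi (rho *: w)] forces [b *: rho = 1], which would put [rho] in [K]. *)
Lemma ext_line_free w : w != 0 -> free [:: phi w; phi (rho *: w)].
Proof.
move=> nz_w; rewrite free_cons seq1_free span_seq1; apply/andP; split.
  apply/vlineP=> -[b]; rewrite -phiZ scalerA => /(can_inj phiK)/eqP.
  rewrite -subr_eq0 -{1}[w]scale1r -scalerBl scaler_eq0 (negPf nz_w).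
  rewrite orbF subr_eq0.
  rewrite mulr_algl => /eqP eq1; case/negP: rho_notin.
  apply/vlineP; exists b^-1.
  rewrite eq1 scalerA mulVf ?scale1r //; apply: contra_eq_neq eq1 => ->.
  by rewrite scale0r oner_neq0.
rewrite -(raddf0 phi) (can_eq phiK) scaler_eq0 (negPf nz_w) orbF.
by apply: contraNneq rho_notin => ->; rewrite mem0v.
Qed.

Lemma dim_ext_line w : w != 0 -> \dim (ext_line w) = 2%N.
Proof. by move/ext_line_free/eqP. Qed.

(** The one-dimensional [E]-subspaces partition the nonzero vectors of [W], and [phi] carries this
    partition to [V]. *)
Lemma desarguesian_ext_lines (S : {vspace V} -> Prop) :
  \dim {:W} = 3%N ->
  (forall L, S L <-> exists2 w, w != 0 & L = ext_line w) ->
  desarguesian_line_spread S.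
Proof.
move=> dimW SE; split; first split=> [L /SE[w nz_w ->]|P].
- exact: dim_ext_line.
- case/dim1_line=> v nz_v ->; have nz_w : psi v != 0.
    by apply: contraNneq nz_v => w0; rewrite -(psiK v) w0 raddf0.
  exists (ext_line (psi v)); split=> [|L [/SE[w nz ->]]].
    split; first by apply/SE; exists (psi v).
    by rewrite -memvE -[v in v \in _]psiK mem_ext_line memv_line.
  rewrite -memvE -[v in v \in _]psiK mem_ext_line memvE => sub.
  have eqL : <[psi v]>%VS = <[w]>%VS.
    by apply/eqP; rewrite eqEdim sub !dim_vline nz nz_w.
  by apply/vspaceP=> x; rewrite -[x]psiK !mem_ext_line eqL.
exists E, W, phi; split=> //; first by exists psi.
move=> L; split=> [/SE[w nz_w ->]|[U /dim1_line[w nz_w ->] LU]].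
  by exists <[w]>%VS => [|u]; rewrite ?dim_vline ?nz_w ?mem_ext_line.
apply/SE; exists w => //; apply/vspaceP=> x.
by rewrite -[x]psiK mem_ext_line LU.
Qed.

(** If [a] and [b] span a singular line, the hypothesis puts [psi b] in the [E]-span of [psi a]; the
    line then lies in [ext_line (psi a)] and equals it by dimension. *)
Lemma singular_lines_ext_lines (T : trilinear_form V) :
  (forall u v, u != 0 ->
     (forall x, T (phi u) (phi v) x = 0) <-> v \in <[u]>%VS) ->
  forall L, singular_line T L <-> exists2 w, w != 0 & L = ext_line w.
Proof.
move=> singE L; split=> [[a [b [free_ab -> Tab]]]|[w nz_w ->]]; last first.
  exists (phi w), (phi (rho *: w)); split=> //; first exact: ext_line_free.
  by apply/singE => //; exact: memvZ (memv_line _).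
have nz_a : psi a != 0.
  apply: contraTneq free_ab => a0.
  by rewrite -(psiK a) a0 raddf0 free_cons mem0v.
exists (psi a) => //; apply/eqP; rewrite eqEdim dim_ext_line // (eqP free_ab).
rewrite leqnn andbT; apply/span_subvP=> x; rewrite !inE => /orP[]/eqP->.
  by rewrite -[a in a \in _]psiK mem_ext_line memv_line.
rewrite -[b in b \in _]psiK mem_ext_line; apply/singE => // y.
by rewrite !psiK.
Qed.

End FieldReduction.

(** * The identification of [V] with [E^n] *)

Section Coordinates.
Variables (K : fieldType) (E : fieldExtType K) (rho : E).
Hypotheses (dimE : \dim {:E} = 2%N) (rho_notin : rho \notin 1%VS).
Variables (V : vectType K) (n : nat) (e : (n + n).-tuple V).
Hypothesis e_basis : basis_of {:V} e.

Definition ext_coord (v : V) : 'rV[E]_n :=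
  \row_i (coord e (lshift n i) v *: 1 + coord e (rshift n i) v *: rho).

Definition base_coord (w : 'rV[E]_n) (i : 'I_(n + n)) : K :=
  match split i with
  | inl j => qcoord rho 1 (w 0 j)
  | inr j => qcoord rho 0 (w 0 j)
  end.

(** Inverse of [ext_coord]; this direction will serve as [phi], so it is the one given an additive
    structure. *)
Definition ext_comb (w : 'rV[E]_n) : V := \sum_i base_coord w i *: e`_i.

Lemma base_coord_linear (a : K) u w i :
  base_coord (a%:A *: u + w) i = a * base_coord u i + base_coord w i.
Proof.
rewrite /base_coord; case: split => j.
  by rewrite !mxE mulr_algl /qcoord linearP.
by rewrite !mxE mulr_algl /qcoord linearP.
Qed.

Lemma ext_combZD (a : K) u w :
  ext_comb (a%:A *: u + w) = a *: ext_comb u + ext_comb w.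
Proof.
rewrite /ext_comb scaler_sumr -big_split; apply: eq_bigr => i _ /=.
by rewrite base_coord_linear scalerDl scalerA.
Qed.

Lemma ext_comb_is_zmod_morphism : zmod_morphism ext_comb.
Proof.
move=> u w; have := ext_combZD (-1) w u.
by rewrite !scaleN1r addrC => ->; rewrite addrC.
Qed.

HB.instance Definition _ :=
  GRing.isZmodMorphism.Build 'rV[E]_n V ext_comb ext_comb_is_zmod_morphism.

Lemma ext_combZ (a : K) u : ext_comb (a%:A *: u) = a *: ext_comb u.
Proof. by have := ext_combZD a u 0; rewrite raddf0 !addr0. Qed.

Lemma ext_combK : cancel ext_comb ext_coord.
Proof.
move=> w; apply/rowP=> i; rewrite mxE /ext_comb.
rewrite !(coord_sum_free _ _ (basis_free e_basis)) /base_coord.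
rewrite -[lshift n i]/(unsplit (inl i)) -[rshift n i]/(unsplit (inr i)).
by rewrite !unsplitK -(qcoordE dimE rho_notin).
Qed.

Lemma ext_coordK : cancel ext_coord ext_comb.
Proof.
move=> v; rewrite [RHS](coord_basis e_basis (memvf v)); apply: eq_bigr => i _.
congr (_ *: _); rewrite /base_coord; case: splitP => j eq_ij.
  rewrite mxE (qcoord_comb dimE rho_notin) /=.
  by congr (coord e _ v); apply: val_inj.
rewrite mxE (qcoord_comb dimE rho_notin) /=.
by congr (coord e _ v); apply: val_inj.
Qed.

End Coordinates.

Arguments ext_coord {K E} rho {V} n e v.
Arguments ext_comb {K E} rho {V} n e w.

(** * Determinants over [E], and the trivector as a coefficient of one *)

Definition det3 (R : pzRingType) (u v w : 'rV[R]_3) : R :=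
  u 0 0 * (v 0 1 * w 0 2 - v 0 2 * w 0 1)
  - u 0 1 * (v 0 0 * w 0 2 - v 0 2 * w 0 0)
  + u 0 2 * (v 0 0 * w 0 1 - v 0 1 * w 0 0).

Lemma det3Zr (R : comPzRingType) (k : R) u v w :
  det3 u v (k *: w) = k * det3 u v w.
Proof. by rewrite /det3 !mxE; ring. Qed.

Lemma ord3P (i : 'I_3) : [\/ i = 0, i = 1 | i = 2].
Proof.
case: i => [[|[|[|//]]] lt_i3]; [apply: Or31|apply: Or32|apply: Or33];
  exact: val_inj.
Qed.

(** Taking unit vectors for [w] shows that all 2-by-2 minors of [u] and [v] vanish; dividing by a
    nonzero entry of [u] makes [v] a multiple of [u]. *)
Lemma det3_vline (L : fieldType) (u v : 'rV[L]_3) :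
  u != 0 -> (forall w, det3 u v w = 0) <-> v \in <[u]>%VS.
Proof.
move=> nz_u; split=> [det0|/vlineP[k ->] w]; last by rewrite /det3 !mxE; ring.
have /rV0Pn[i nz_ui] := nz_u.
have minor0 j : u 0 i * v 0 j = u 0 j * v 0 i.
  have [d0 d1 d2] : [/\ u 0 1 * v 0 2 = u 0 2 * v 0 1,
      u 0 0 * v 0 2 = u 0 2 * v 0 0 & u 0 0 * v 0 1 = u 0 1 * v 0 0].
    split; apply/eqP; rewrite -subr_eq0.
    + by rewrite -(det0 (delta_mx 0 0)) /det3 !mxE /=; apply/eqP; ring.
    + rewrite -oppr_eq0 -(det0 (delta_mx 0 1)) /det3 !mxE /=.
      by apply/eqP; ring.
    + by rewrite -(det0 (delta_mx 0 2)) /det3 !mxE /=; apply/eqP; ring.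
  by case: (ord3P i) => ->; case: (ord3P j) => ->.
apply/vlineP; exists (v 0 i / u 0 i); apply/rowP=> j; rewrite mxE.
by rewrite mulrAC mulrC -[_ * u 0 j]mulrC -minor0 mulKf.
Qed.

(* Both trivectors of the theorem: the first one is the case [mu = 0]. *)
Definition spread_trivector (K : fieldType) (V : vectType K)
    (e : 6.-tuple V) (mu : K) : trilinear_form V :=
  dual_wedge e 2 3 4 + dual_wedge e 1 3 5 + dual_wedge e 1 2 6
  + dual_wedge e 1 5 6 + dual_wedge e 2 4 6 + dual_wedge e 3 4 5
  + mu *: dual_wedge e 4 5 6.

Lemma spread_trivectorE (K : fieldType) (E : fieldExtType K) (rho : E) (mu : K)
    (V : vectType K) (e : 6.-tuple V) (x y z : V) :
  2%N \in [pchar K] -> \dim {:E} = 2%N -> rho \notin 1%VS ->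
  rho ^+ 2 = rho + (mu + 1)%:A ->
  let c := ext_coord rho 3 e in
  spread_trivector e mu x y z = qcoord rho 0 (det3 (c x) (c y) (c z)).
Proof.
move=> char2 dimE rho_notin rho2 c.
have char2E : 2%N \in [pchar E] by rewrite pchar_lalg.
have rho3 : rho ^+ 3 = mu%:A * rho + (mu + 1)%:A.
  rewrite exprSr rho2 mulrDl -expr2 rho2 scalerDl scale1r.
  (* The left side has two surplus copies of [rho]; adding [rho + rho = 0] on the right leaves an
     identity for [ring]. *)
  rewrite -[RHS]addr0 -(addrr_pchar2 char2E rho).
  ring.
have low : (lshift 3 (0 : 'I_3) = inord 0 :> 'I_6)
    * (lshift 3 (1 : 'I_3) = inord 1 :> 'I_6)
    * (lshift 3 (2 : 'I_3) = inord 2 :> 'I_6).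
  by do !split; apply: val_inj; rewrite /= inordK.
have high : (rshift 3 (0 : 'I_3) = inord 3 :> 'I_6)
    * (rshift 3 (1 : 'I_3) = inord 4 :> 'I_6)
    * (rshift 3 (2 : 'I_3) = inord 5 :> 'I_6).
  by do !split; apply: val_inj; rewrite /= inordK.
rewrite /spread_trivector /dual_wedge.
rewrite !(add_lfunE, scale_lfunE, wedge3E, pairingE, dual_basisE) /=.
rewrite /det3 !mxE !low !high.
set k := coord e.
have algE a b : a *: 1 + b *: rho = GRing.in_alg E a + GRing.in_alg E b * rho.
  by rewrite !in_algE mulr_algl.
rewrite !algE !(oppr_pchar2 char2) !(oppr_pchar2 char2E).
(* [m i j l] is the 3-by-3 minor on coordinates [i], [j], [l], its signs dropped in characteristic
   2. Below, [m0] to [m3] are the coefficients of the powers of [rho] in the determinant. *)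
pose m i j l : K := k i x * (k j y * k l z + k l y * k j z)
  + k i y * (k j x * k l z + k l x * k j z)
  + k i z * (k j x * k l y + k l x * k j y).
set D := (X in qcoord _ _ X).
pose m0 := m (inord 0) (inord 1) (inord 2).
pose m1 := m (inord 1) (inord 2) (inord 3) + m (inord 0) (inord 2) (inord 4)
  + m (inord 0) (inord 1) (inord 5).
pose m045 := m (inord 0) (inord 4) (inord 5).
pose m135 := m (inord 1) (inord 3) (inord 5).
pose m234 := m (inord 2) (inord 3) (inord 4).
pose m2 := m045 + m135 + m234.
pose m3 := m (inord 3) (inord 4) (inord 5).
(* Reducing [rho ^+ 2] and [rho ^+ 3] gives this. The terms of [m2] stay apart so that the
   coefficient of [rho] is bracketed like the trivector. *)
have -> : D = (m0 + (mu + 1) * (m2 + m3))%:A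
    + (m1 + m045 + m135 + m234 + mu * m3) *: rho.
  transitivity (GRing.in_alg E m0 + GRing.in_alg E m1 * rho
    + GRing.in_alg E m2 * rho ^+ 2 + GRing.in_alg E m3 * rho ^+ 3).
    by rewrite /D /m0 /m1 /m2 /m045 /m135 /m234 /m3 /m; ring.
  rewrite rho2 rho3 algE -!in_algE /m2; ring.
by rewrite (qcoord_comb dimE rho_notin).
Qed.

(** * From an irreducible quadratic to the spread *)

Lemma spread_trivector_desarguesian (K : fieldType) (V : vectType K)
    (e : 6.-tuple V) (mu : K) :
  2%N \in [pchar K] -> basis_of {:V} e ->
  (forall a : K, a ^+ 2 + a != mu + 1) ->
  desarguesian_line_spread (singular_line (spread_trivector e mu)).
Proof.
move=> char2 e_basis no_root.
pose p : {poly K} := 'X^2 + ('X + (mu + 1)%:P).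
have size_p : size p = 3%N by rewrite size_polyDl size_polyXn // size_XaddC.
have rootp a : root p a = (a ^+ 2 + a == mu + 1).
  rewrite rootE !(hornerD, hornerXn, hornerX, hornerC) addrA.
  by rewrite -[RHS]subr_eq0 (oppr_pchar2 char2).
have irr_p : irreducible_poly p.
  (* In degree at most 3, having no root is enough for irreducibility. *)
  by apply: cubic_irreducible => [|a]; rewrite ?size_p // rootp.
have [E dimE [rho root_rho _]] := irredp_FAdjoin irr_p.
rewrite size_p /= in dimE.
have rho_notin : rho \notin 1%VS.
  apply/vlineP=> -[a rhoE]; move: root_rho.
  by rewrite rhoE -in_algE fmorph_root rootp (negPf (no_root a)).
have rho2 : rho ^+ 2 = rho + (mu + 1)%:A.
  apply/eqP; rewrite -subr_eq0 oppr_pchar2 ?pchar_lalg // addrA.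
  move: root_rho; rewrite rootE 2!rmorphD rmorphXn /= map_polyX map_polyC.
  by rewrite !(hornerD, hornerXn, hornerX, hornerC) addrA.
pose phi : {additive 'rV[E]_3 -> V} := ext_comb rho 3 e.
have coordK : cancel phi _ := @ext_combK _ _ _ dimE rho_notin _ 3 e e_basis.
have combK : cancel _ phi := @ext_coordK _ _ _ dimE rho_notin _ 3 e e_basis.
have combZ := @ext_combZ K E rho V 3 e.
apply: (desarguesian_ext_lines dimE rho_notin coordK combK combZ).
  by rewrite dimvf dim_matrix.
apply: (singular_lines_ext_lines dimE rho_notin coordK combK combZ).
move=> u v nz_u; rewrite -(det3_vline _ nz_u).
have TE x : spread_trivector e mu (ext_comb rho 3 e u)
    (ext_comb rho 3 e v) x
    = qcoord rho 0 (det3 u v (ext_coord rho 3 e x)).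
  by rewrite (spread_trivectorE (rho := rho)) // !coordK.
split=> [T0 w|det0 x]; last by rewrite TE det0 /qcoord linear0.
apply/eqP/negPn/negP=> nz_det.
(* This multiple of [w] brings the determinant to [rho], whose coefficient of [rho] is 1, not 0. *)
have := T0 (ext_comb rho 3 e ((rho / det3 u v w) *: w)).
rewrite TE coordK.
have -> : det3 u v ((rho / det3 u v w) *: w) = 0 *: 1 + 1 *: rho.
  by rewrite det3Zr divfK // scale0r add0r scale1r.
by rewrite (qcoord_comb dimE rho_notin) => /eqP; rewrite oner_eq0.
Qed.

(** A value [a ^+ 2 + a] has trace 0. *)
Lemma trace1_no_root (F : finFieldType) (h : nat) (mu a : F) :
  #|F| = (2 ^ h)%N -> 2%N \in [pchar F] ->
  absolute_trace h (mu + 1) = 1 -> a ^+ 2 + a != mu + 1.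
Proof.
move=> cardF char2 tr1; apply: contra_eq_neq tr1 => <-.
by rewrite absolute_trace_AS // eq_sym oner_neq0.
Qed.

Theorem theorem7 (h : nat) (F : finFieldType) (V : vectType F)
    (e : 6.-tuple V) (h_ge1 : (1 <= h)%N) (card_F : #|F| = (2 ^ h)%N)
    (e_basis : basis_of {:V} e) :
  (odd h ->
     let t := dual_wedge e 2 3 4 + dual_wedge e 1 3 5 + dual_wedge e 1 2 6
              + dual_wedge e 1 5 6 + dual_wedge e 2 4 6 + dual_wedge e 3 4 5 in
     desarguesian_line_spread (singular_line t)) /\
  (~~ odd h ->
     forall mu : F, absolute_trace h mu = 1 ->
     let t := dual_wedge e 2 3 4 + dual_wedge e 1 3 5 + dual_wedge e 1 2 6
              + dual_wedge e 1 5 6 + dual_wedge e 2 4 6 + dual_wedge e 3 4 5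
              + mu *: dual_wedge e 4 5 6 in
     desarguesian_line_spread (singular_line t)).
Proof.
have char2 : 2%N \in [pchar F] := card_finPcharP card_F isT.
(* The trace of 1 is the parity of [h], so [mu + 1] has trace 1 in both cases: [mu = 0] for odd [h],
   and [mu] of trace 1 for even [h]. *)
have trace1 : absolute_trace h (1 : F) = (odd h)%:R.
  rewrite absolute_trace1 -{1}(odd_double_half h) natrD -mul2n natrM.
  by rewrite (pcharf0 char2) mul0r addr0.
split=> [h_odd|h_even mu tr_mu] t; last first.
  apply: spread_trivector_desarguesian => // a.
  apply: (trace1_no_root (h := h)) => //.
  by rewrite absolute_traceD // tr_mu trace1 (negPf h_even) addr0.
have -> : t = spread_trivector e 0 by rewrite /spread_trivector scale0r addr0.
apply: spread_trivector_desarguesian => // a.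
apply: (trace1_no_root (h := h)) => //.
by rewrite add0r trace1 h_odd.
Qed.
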